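(* Let $\mathcal{D}\in\mathbb{R}^{m\times n}$ be a matrix with $\operatorname{rank}(\mathcal{D})=r\le\min\{m,n\}$. Let $T_i$ denote a set of row indices of $\mathcal{D}$ such that $|T_i|=r$ and $\operatorname{rank}(\mathcal{D}_{T_i})=r$. The dictionary for an equivalent synthesis problem, corresponding to the analysis problem with analysis operator $\mathcal{D}$, is found by going through the following steps. 1. Find all possible $T_i$'s. 2. Find $n-r$ rows spanning $\mathcal{N}(\mathcal{D})=\mathcal{N}(\mathcal{D}_{T_i})$, for all $i$. Write them in the matrix $A\in\mathbb{R}^{(n-r)\times n}$. 3. Invert $B_i=\begin{pmatrix}A\\ \mathcal{D}_{T_i}\end{pmatrix}$ to find $B_i^{-1}=\begin{pmatrix}J&\tilde{\mathcal{X}}^i\end{pmatrix}$, with $\tilde{\mathcal{X}}^i\in\mathbb{R}^{n\times r}$. 4. Write $\tilde{\mathcal{X}}=\{\tilde{\mathcal{X}}^i\}_i$, the matrix collecting the columns of all the $\tilde{\mathcal{X}}^i$. 5. Normalize the columns of $\tilde{\mathcal{X}}$ to obtain the normalized dictionary $\mathcal{X}$, such that the columns of $\mathcal{D}\mathcal{X}$ have $\ell^1$-norm equal to $1$. 6. Prune the dictionary $\mathcal{X}$, i.e. discard a column with index $k$ if $\mathcal{X}_k$ is in the convex hull of $\pm\mathcal{X}_{-k}$. 7. Obtain the dictionary $\mathcal{X}$.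
   Context: For $v\in\mathbb{R}^n$, $\|v\|_n^2=\|v\|_2^2/n$. Given observations $Y\in\mathbb{R}^n$ and a tuning parameter $\lambda>0$, the analysis problem with analysis operator $\mathcal{D}\in\mathbb{R}^{m\times n}$ is to compute the analysis estimator $\hat f_{\mathrm A}=\arg\min_{f\in\mathbb{R}^n}\{\|Y-f\|_n^2+2\lambda\|\mathcal{D}f\|_1\}$. A synthesis problem with dictionary $\mathcal{X}$ (a matrix with $n$ rows, whose columns are called atoms) estimates the signal by a linear combination of the atoms, with coefficient vector obtained by minimizing the squared error $\|Y-\mathcal{X}\beta\|_n^2$ plus the penalty $2\lambda\|\beta\|_1$. A synthesis problem is called equivalent to an analysis problem if it describes the same estimator; here, when $r<n$, this is understood with the columns of $J$, which span $\mathcal{N}(\mathcal{D})$, added to the dictionary as atoms whose coefficients are not penalized. For a set $T$ of row indices, $\mathcal{D}_T$ is the submatrix of $\mathcal{D}$ consisting of the rows with index in $T$. $\mathcal{N}(M)$ denotes the nullspace of a matrix $M$. $\mathcal{X}_k$ denotes the $k$-th column of $\mathcal{X}$, and $\mathcal{X}_{-k}$ the collection of all its other columns; $\pm\mathcal{X}_{-k}$ is the collection of these columns and their negatives. The block $J\in\mathbb{R}^{n\times(n-r)}$ is the same for all $i$. *)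

(* Defs.v *)
From HB Require Import structures.
From mathcomp Require Export all_boot all_order all_algebra.
From mathcomp Require Export reals.

Set Implicit Arguments.
Unset Strict Implicit.
Unset Printing Implicit Defensive.

Import Order.TTheory GRing.Theory Num.Theory.
Local Open Scope ring_scope.

Section Estimators.
Variable R : realType.

Definition l1norm p (v : 'cV[R]_p) : R := \sum_i `|v i 0|.

Definition sqnorm_n n (v : 'cV[R]_n) : R := (\sum_i v i 0 ^+ 2) / n%:R.

Definition is_argmin (T : Type) (F : T -> R) (x : T) : Prop :=
  forall y, F x <= F y.

Definition analysis_objective m n (D : 'M[R]_(m, n)) (Y : 'cV[R]_n) (lambda : R)
    (f : 'cV[R]_n) : R :=
  sqnorm_n (Y - f) + 2 * lambda * l1norm (D *m f).

Definition analysis_estimator m n (D : 'M[R]_(m, n)) (Y : 'cV[R]_n) (lambda : R)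
    (f : 'cV[R]_n) : Prop :=
  is_argmin (analysis_objective D Y lambda) f.

(* The coefficients are a pair: the first component, on the atoms of X, is
   penalized; the second one, on the columns of J, is not. *)
Definition synthesis_objective n p q (X : 'M[R]_(n, p)) (J : 'M[R]_(n, q))
    (Y : 'cV[R]_n) (lambda : R) (b : 'cV[R]_p * 'cV[R]_q) : R :=
  sqnorm_n (Y - (X *m b.1 + J *m b.2)) + 2 * lambda * l1norm b.1.

Definition synthesis_estimator n p q (X : 'M[R]_(n, p)) (J : 'M[R]_(n, q))
    (Y : 'cV[R]_n) (lambda : R) (f : 'cV[R]_n) : Prop :=
  exists2 b, is_argmin (synthesis_objective X J Y lambda) b
           & f = X *m b.1 + J *m b.2.

Definition equivalent_synthesis m n p q (D : 'M[R]_(m, n))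
    (X : 'M[R]_(n, p)) (J : 'M[R]_(n, q)) : Prop :=
  forall (Y : 'cV[R]_n) (lambda : R), 0 < lambda ->
  forall f, analysis_estimator D Y lambda f <-> synthesis_estimator X J Y lambda f.

End Estimators.

Section Dictionary.
Variable R : realType.

(* kermx is the left kernel, so the transposes of the rows of [nullspace M]
   span {x | M *m x = 0}. *)
Definition nullspace m n (M : 'M[R]_(m, n)) : 'M[R]_n := kermx M^T.

Definition subrows m n (D : 'M[R]_(m, n)) (T : {set 'I_m}) : 'M[R]_(#|T|, n) :=
  rowsub (fun k : 'I_#|T| => enum_val k) D.

Definition row_bases m n (D : 'M[R]_(m, n)) (r : nat) : {set {set 'I_m}} :=
  [set T : {set 'I_m} | (#|T| == r) && (\rank (subrows D T) == r)].

Definition stacked m n q (A : 'M[R]_(q, n)) (D : 'M[R]_(m, n)) (T : {set 'I_m}) :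
    'M[R]_(q + #|T|, n) := col_mx A (subrows D T).

(* [stacked A D T] is square only up to the propositional equality
   q + #|T| = n, whereas invmx takes an 'M_n: when that equality holds, both
   uses of conform_mx merely change the dimensions in the type (the default
   matrix 0 is returned only when it fails). *)
Definition stacked_inv m n q (A : 'M[R]_(q, n)) (D : 'M[R]_(m, n)) (T : {set 'I_m}) :
    'M[R]_(n, q + #|T|) :=
  conform_mx (0 : 'M[R]_(n, q + #|T|))
    (invmx (conform_mx (0 : 'M[R]_n) (stacked A D T))).

Definition atoms_block m n q (A : 'M[R]_(q, n)) (D : 'M[R]_(m, n)) (T : {set 'I_m}) :
    'M[R]_(n, #|T|) := rsubmx (stacked_inv A D T).

Definition raw_dictionary m n q (A : 'M[R]_(q, n)) (D : 'M[R]_(m, n)) (r : nat) :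
    'M[R]_(n, \sum_(i < #|row_bases D r|) #|enum_val i|) :=
  \mxrow_(i < #|row_bases D r|) atoms_block A D (enum_val i).

Definition normalize_atoms m n p (D : 'M[R]_(m, n)) (X : 'M[R]_(n, p)) :
    'M[R]_(n, p) :=
  \matrix_(i, k) (X i k / l1norm (D *m col k X)).

Definition in_convex_hull n p (M : 'M[R]_(n, p)) (x : 'cV[R]_n) : Prop :=
  exists w : 'cV[R]_p,
    [/\ forall k, 0 <= w k 0, \sum_k w k 0 = 1 & x = M *m w].

Definition redundant n p (X : 'M[R]_(n, p)) (k : 'I_p) : Prop :=
  in_convex_hull (row_mx (col' k X) (- col' k X)) (col k X).

(* Columns are discarded one at a time, each test being made against the columns
   still present: discarding all redundant columns at once would remove every
   copy of an atom that occurs twice up to sign. The order is arbitrary, and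
   pruning stops when no redundant column is left. *)
Inductive prunes_to n : forall p q, 'M[R]_(n, p) -> 'M[R]_(n, q) -> Prop :=
| prunes_stop p (X : 'M[R]_(n, p)) :
    (forall k, ~ redundant X k) -> prunes_to X X
| prunes_discard p q (X : 'M[R]_(n, p)) (k : 'I_p) (Z : 'M[R]_(n, q)) :
    redundant X k -> prunes_to (col' k X) Z -> prunes_to X Z.

End Dictionary.

(* Main.v *)
Require Import Defs.
From mathcomp Require Import boolp.
From mathcomp Require Import zify ring.

(** Writing a signal as f = X b + J c, the analysis and the synthesis problem
    have the same squared error, so they describe the same estimator as soon as
    ||Df||_1 is the smallest value of ||b||_1 over all such representations
    ([exact_dictionary], [exact_equivalent]).

    One inequality is the triangle inequality, because DJ = 0 and every atom x
    is normalized to ||Dx||_1 = 1. The other one says that the polytope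
    {f | ||Df||_1 <= 1}, modulo the nullspace of D, is the convex hull of the
    atoms and their negatives. It is proved here without vertices. Call f
    elementary if Df is nonzero and is, up to a scalar, the only vector of the
    range of D that vanishes wherever Df does. If f is not elementary, Df splits
    as a sum of two vectors of the range that have no sign conflict and strictly
    smaller supports ([conformal_split]); such a splitting adds l1-norms, so by
    induction on the support ([conformal_ind]) only elementary f remain. For
    those, the rows of D vanishing at f have rank r - 1; a basis of them,
    completed by one row i not vanishing at f, is one of the sets T
    ([elementary_basis]), and modulo the nullspace f is a multiple of the atom
    that T attaches to i.

    Discarding a redundant atom preserves exactness ([exact_discard]): in any
    representation, the atom can be replaced by a combination of the others and
    their negatives whose coefficients have total absolute value one.

    The matrix B = (A; D_T) is invertible because a vector of its kernel lies
    both in the nullspace of D and in its orthogonal complement. The block J is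
    characterized by AJ = 1 and DJ = 0, which do not mention T; this is why it
    is the same for all T ([stacked_inv_kernel_block]). *)

Set Implicit Arguments.
Unset Strict Implicit.
Unset Printing Implicit Defensive.

Import Order.TTheory GRing.Theory Num.Theory.
Local Open Scope ring_scope.

(** * The l1-norm *)

Lemma l1norm_ge0 (R : realType) p (v : 'cV[R]_p) : 0 <= l1norm v.
Proof. exact: sumr_ge0. Qed.

Lemma l1norm_eq0 (R : realType) p (v : 'cV[R]_p) : l1norm v = 0 -> v = 0.
Proof.
move=> /eqP; rewrite psumr_eq0 // => /allP v0; apply/colP => i.
by rewrite mxE; apply/eqP; rewrite -normr_eq0; apply: v0 (mem_index_enum i).
Qed.

Lemma l1normD (R : realType) p (u v : 'cV[R]_p) :
  l1norm (u + v) <= l1norm u + l1norm v.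
Proof.
rewrite -big_split; apply: ler_sum => i _; rewrite mxE; exact: ler_normD.
Qed.

Lemma l1normZ (R : realType) p (a : R) (v : 'cV[R]_p) :
  l1norm (a *: v) = `|a| * l1norm v.
Proof. by rewrite mulr_sumr; apply: eq_bigr => i _; rewrite mxE normrM. Qed.

Lemma l1norm0 (R : realType) p : l1norm (0 : 'cV[R]_p) = 0.
Proof. by rewrite -(scale0r 0) l1normZ normr0 mul0r. Qed.

Lemma l1norm_delta (R : realType) p (k : 'I_p) :
  l1norm (delta_mx k 0 : 'cV[R]_p) = 1.
Proof.
rewrite /l1norm (bigD1 k) //= mxE !eqxx normr1 big1 ?addr0 // => i /negPf ik.
by rewrite mxE ik normr0.
Qed.

Lemma l1norm_mulmx_le (R : realType) m n (M : 'M[R]_(m, n)) (v : 'cV[R]_n) :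
  l1norm (M *m v) <= \sum_k `|v k 0| * l1norm (col k M).
Proof.
under [leRHS]eq_bigr => k _ do rewrite mulr_sumr.
rewrite exchange_big; apply: ler_sum => i _; rewrite mxE.
apply: le_trans (ler_norm_sum _ _ _) _; apply: ler_sum => k _.
by rewrite mxE normrM mulrC.
Qed.

(** * Splitting off one column *)

Lemma col_mulmx (R : pzSemiRingType) m n p k (M : 'M[R]_(m, n)) (X : 'M[R]_(n, p)) :
  col k (M *m X) = M *m col k X.
Proof. by rewrite !colE mulmxA. Qed.

Lemma mulmx_col' (R : comPzRingType) n p (k : 'I_p) (X : 'M[R]_(n, p)) (b : 'cV[R]_p) :
  X *m b = b k 0 *: col k X + col' k X *m row' k b.
Proof.
apply/colP => i; rewrite !mxE (bigD1_ord k) //= mulrC; congr (_ + _).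
by apply: eq_bigr => j _; rewrite !mxE.
Qed.

Lemma l1norm_row' (R : realType) p (k : 'I_p) (b : 'cV[R]_p) :
  l1norm b = `|b k 0| + l1norm (row' k b).
Proof.
rewrite /l1norm (bigD1_ord k) //=; congr (_ + _).
by apply: eq_bigr => j _; rewrite !mxE.
Qed.

Lemma l1norm_col_mx (R : realType) p q (u : 'cV[R]_p) (v : 'cV[R]_q) :
  l1norm (col_mx u v) = l1norm u + l1norm v.
Proof.
rewrite /l1norm big_split_ord /=.
by congr (_ + _); apply: eq_bigr => i _; rewrite ?col_mxEu ?col_mxEd.
Qed.

(** * Nullspaces and ranks *)

Lemma nullspaceP (R : realType) m n (M : 'M[R]_(m, n)) (x : 'cV[R]_n) :
  reflect (M *m x = 0) (x^T <= nullspace M)%MS.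
Proof.
apply: (iffP sub_kermxP); rewrite -trmx_mul; last by move=> ->; rewrite trmx0.
by move/(congr1 trmx); rewrite trmxK trmx0.
Qed.

Lemma rank_nullspace (R : realType) m n (M : 'M[R]_(m, n)) :
  \rank (nullspace M) = (n - \rank M)%N.
Proof. by rewrite mxrank_ker mxrank_tr. Qed.

Lemma submx_kernel (R : realType) m1 m2 n (M : 'M[R]_(m1, n)) (N : 'M[R]_(m2, n)) :
  (M <= N)%MS -> forall p (x : 'M[R]_(n, p)), N *m x = 0 -> M *m x = 0.
Proof. by case/submxP => u -> p x Nx; rewrite -mulmxA Nx mulmx0. Qed.

Lemma nullspaceS (R : realType) m1 m2 n (M : 'M[R]_(m1, n)) (N : 'M[R]_(m2, n)) :
  (forall x : 'cV_n, M *m x = 0 -> N *m x = 0) -> (nullspace M <= nullspace N)%MS.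
Proof.
move=> MN; apply/row_subP => i; rewrite -[row i _]trmxK; apply/nullspaceP/MN.
by apply/nullspaceP; rewrite trmxK row_sub.
Qed.

Lemma kernel_rank_ge (R : realType) m1 m2 n (M : 'M[R]_(m1, n)) (N : 'M[R]_(m2, n)) :
  (forall x : 'cV_n, M *m x = 0 -> N *m x = 0) -> (\rank N <= \rank M)%N.
Proof.
move=> /nullspaceS /mxrankS; rewrite !rank_nullspace.
have := rank_leq_col M; have := rank_leq_col N; lia.
Qed.

Lemma kernel_rank_eq (R : realType) m1 m2 n (M : 'M[R]_(m1, n)) (N : 'M[R]_(m2, n)) :
  (M <= N)%MS -> \rank M = \rank N ->
  forall p (x : 'M[R]_(n, p)), M *m x = 0 -> N *m x = 0.
Proof.
move=> MN rMN p x; apply: submx_kernel.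
by have := mxrank_leqif_sup MN => -[_ <-]; rewrite rMN.
Qed.

(** * Row bases *)

Lemma subrows_mul (R : realType) m n p (D : 'M[R]_(m, n)) (T : {set 'I_m})
    (x : 'M[R]_(n, p)) : subrows D T *m x = subrows (D *m x) T.
Proof. by rewrite mul_rowsub_mx. Qed.

Lemma subrows0P (R : realType) m (v : 'cV[R]_m) (T : {set 'I_m}) :
  subrows v T = 0 <-> {in T, forall i, v i 0 = 0}.
Proof.
split=> [v0 i iT|v0].
  have /colP/(_ (enum_rank_in iT i)) := v0.
  by rewrite !mxE enum_rankK_in.
by apply/colP => i; rewrite !mxE v0 // enum_valP.
Qed.

Lemma subrows_sub (R : realType) m n (D : 'M[R]_(m, n)) (T : {set 'I_m}) :
  (subrows D T <= D)%MS.
Proof. by apply/row_subP => i; rewrite row_rowsub row_sub. Qed.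

(** A maximal independent family of the rows in S. Independence is recorded only
    as the cardinality of T, from which it follows. *)
Lemma subrows_basis (R : realType) m n (D : 'M[R]_(m, n)) (S : {set 'I_m}) :
  exists T : {set 'I_m}, [/\ T \subset S, #|T| = \rank (subrows D S)
    & (subrows D S <= subrows D T)%MS].
Proof.
set f := maxrankfun (subrows D S).
pose g k : 'I_m := enum_val (f k).
have injg : injective g by move=> i j /enum_val_inj; apply: maxrankfun_inj.
exists [set g k | k : 'I_(\rank (subrows D S))]; split.
- by apply/subsetP => _ /imsetP [k _ ->]; apply: enum_valP.
- by rewrite card_imset // card_ord.
- rewrite -(eq_maxrowsub (subrows D S)); apply/row_subP => k.
  have gT : g k \in [set g k | k : 'I_(\rank (subrows D S))] by apply: imset_f.
  rewrite row_rowsub row_rowsub -/f -/(g k) -(enum_rankK_in gT gT).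
  by rewrite -(row_rowsub (fun i => enum_val i)) row_sub.
Qed.

Lemma row_basesP (R : realType) m n (D : 'M[R]_(m, n)) r (T : {set 'I_m}) :
  reflect (#|T| = r /\ \rank (subrows D T) = r) (T \in row_bases D r).
Proof. by rewrite inE; apply: (iffP andP) => -[/eqP ? /eqP ?]. Qed.

Lemma row_bases_neq0 (R : realType) m n (D : 'M[R]_(m, n)) :
  exists T, T \in row_bases D (\rank D).
Proof.
have [T [_ cT sT]] := subrows_basis D [set: 'I_m].
have sD : (D <= subrows D [set: 'I_m])%MS.
  apply/row_subP => i; rewrite -(enum_rankK_in (in_setT i) (in_setT i)).
  by rewrite -(row_rowsub (fun i => enum_val i)) row_sub.
have e : \rank (subrows D [set: 'I_m]) = \rank D.
  by apply/eqP; rewrite eqn_leq !mxrankS ?subrows_sub.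
exists T; apply/row_basesP; split; first by rewrite cT e.
by apply/eqP; rewrite eqn_leq !mxrankS ?subrows_sub ?(submx_trans sD).
Qed.

(** D_T has rank r and its rows are rows of D, so both have the same row
    space. *)
Lemma row_bases_kernel (R : realType) m n (D : 'M[R]_(m, n)) (T : {set 'I_m}) :
  T \in row_bases D (\rank D) ->
  forall p (x : 'M[R]_(n, p)), subrows D T *m x = 0 -> D *m x = 0.
Proof. by move=> /row_basesP [_ rT]; apply: kernel_rank_eq; rewrite ?subrows_sub. Qed.

Lemma row_bases_nullspace (R : realType) m n (D : 'M[R]_(m, n)) (T : {set 'I_m}) :
  T \in row_bases D (\rank D) -> (nullspace (subrows D T) == nullspace D)%MS.
Proof.
move=> TD; apply/andP; split; apply: nullspaceS => x.
  exact: row_bases_kernel.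
exact/submx_kernel/subrows_sub.
Qed.

(** * The inverses of the stacked matrices *)

(** Stated for a matrix M that is square only up to an equation between its
    dimensions; once this equation is eliminated, both uses of [conform_mx]
    disappear and injectivity makes M invertible. *)
Lemma conform_invmx (R : realType) p n (e : p = n) (M : 'M[R]_(p, n)) :
  (forall x : 'cV_n, M *m x = 0 -> x = 0) ->
  let N := conform_mx (0 : 'M[R]_(n, p)) (invmx (conform_mx (0 : 'M_n) M)) in
  M *m N = 1%:M /\ N *m M = 1%:M.
Proof.
case: n / e M => M injM /=; rewrite !conform_mx_id.
suff uM : M \in unitmx by rewrite mulmxV ?mulVmx.
rewrite -row_full_unit -col_leq_rank -[X in (X <= _)%N](mxrank1 R).
by apply: kernel_rank_ge => x; rewrite mul1mx; apply: injM.
Qed.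

Section StackedInverse.
Variables (R : realType) (m n : nat) (D : 'M[R]_(m, n)).
Variable A : 'M[R]_(n - \rank D, n).
Hypothesis nullA : (A == nullspace D)%MS.

(** If D_T x = 0 then Dx = 0, so x^T is a combination u A of the rows of A;
    then Ax = 0 gives x^T x = u A x = 0, whence x = 0 over the reals. *)
Lemma stacked_inj (T : {set 'I_m}) (x : 'cV_n) :
  T \in row_bases D (\rank D) -> stacked A D T *m x = 0 -> x = 0.
Proof.
move=> TD; rewrite mul_col_mx -col_mx0 => /eq_col_mx [Ax Tx].
have /nullspaceP := row_bases_kernel TD Tx.
rewrite -(eqmxP nullA) => /submxP [u xu].
have : l1norm x = 0; last exact: l1norm_eq0.
have xx : x^T *m x = 0 by rewrite xu -mulmxA Ax mulmx0.
apply: big1 => i _; apply/eqP; rewrite normr_eq0.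
have /eqP : \sum_j x j 0 ^+ 2 = 0.
  move/matrixP: xx => /(_ 0 0); rewrite !mxE => xx.
  by rewrite -[RHS]xx; apply: eq_bigr => j _; rewrite mxE expr2.
rewrite psumr_eq0 => [|j _]; last exact: sqr_ge0.
by move/allP/(_ i (mem_index_enum i)); rewrite /= sqrf_eq0.
Qed.

Lemma stacked_invP (T : {set 'I_m}) : T \in row_bases D (\rank D) ->
  stacked A D T *m stacked_inv A D T = 1%:M /\
  stacked_inv A D T *m stacked A D T = 1%:M.
Proof.
move=> TD; apply: conform_invmx => [|x]; last exact: stacked_inj.
by case/row_basesP: TD => cT _; rewrite cT subnK ?rank_leq_col.
Qed.

Lemma stacked_blocks (T : {set 'I_m}) (J := lsubmx (stacked_inv A D T)) :
  T \in row_bases D (\rank D) ->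
  [/\ A *m J = 1%:M, D *m J = 0
    & subrows D T *m atoms_block A D T = 1%:M].
Proof.
move=> TD; have [+ _] := stacked_invP TD.
rewrite -[stacked_inv A D T]hsubmxK mul_col_row scalar_mx_block.
by case/eq_block_mx => AJ _ /(row_bases_kernel TD) DJ DX.
Qed.

(** Two left blocks J with AJ = 1 and DJ = 0 have the same image under the
    invertible matrix (A; D_T), so the left block of the inverse does not depend
    on T. *)
Lemma stacked_inv_kernel_block (T : {set 'I_m}) (J : 'M_(n, n - \rank D)) :
  T \in row_bases D (\rank D) -> A *m J = 1%:M -> D *m J = 0 ->
  row_mx J (atoms_block A D T) = stacked_inv A D T.
Proof.
move=> TD AJ DJ; have [AL DL _] := stacked_blocks TD.
have [_ VS] := stacked_invP TD.
rewrite -[RHS]hsubmxK; congr row_mx.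
rewrite -[LHS]mul1mx -[RHS]mul1mx -VS -!mulmxA; congr (_ *m _).
by rewrite !mul_col_mx AJ AL !(submx_kernel (subrows_sub D T)).
Qed.

Lemma atomP (T : {set 'I_m}) (j : 'I_#|T|) (x := col j (atoms_block A D T)) :
  T \in row_bases D (\rank D) -> subrows D T *m x = delta_mx j 0.
Proof.
by move=> /stacked_blocks [_ _ DX]; rewrite /x -col_mulmx DX col1.
Qed.

Lemma atom_neq0 (T : {set 'I_m}) (j : 'I_#|T|) :
  T \in row_bases D (\rank D) -> l1norm (D *m col j (atoms_block A D T)) != 0.
Proof.
move=> TD; apply/eqP => /l1norm_eq0 /(submx_kernel (subrows_sub D T)).
rewrite atomP // => /matrixP /(_ j 0); rewrite !mxE !eqxx => /eqP.
by rewrite oner_eq0.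
Qed.

Lemma col_raw_dictionary k : exists (T : {set 'I_m}) (j : 'I_#|T|),
  T \in row_bases D (\rank D) /\
  col k (raw_dictionary A D (\rank D)) = col j (atoms_block A D T).
Proof.
exists (enum_val (tagnat.sig1 k)), (tagnat.sig2 k); split; first exact: enum_valP.
by apply/colP => i; rewrite !mxE.
Qed.

(** The columns of the block of T are columns of the raw dictionary; together
    with [col_raw_dictionary] this is all that is used of its block
    structure. *)
Lemma atom_raw_dictionary (T : {set 'I_m}) (j : 'I_#|T|) :
  T \in row_bases D (\rank D) ->
  exists k, col k (raw_dictionary A D (\rank D)) = col j (atoms_block A D T).
Proof.
move=> TD; have eT := enum_rankK_in TD TD; move: (enum_rank_in TD T) eT => i eT.
(* Replacing T by [enum_val i] avoids casting j to another index type. *)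
case: T / eT j {TD} => j.
exists (tagnat.Rank i j).
rewrite -(mxrowK (fun i => atoms_block A D (enum_val i)) i).
by apply/colP => l; rewrite !mxE.
Qed.

End StackedInverse.

(** The columns of J lie in the nullspace, are independent because AJ = 1, and
    there are as many of them as its dimension. *)
Lemma kernel_block_span (R : realType) m n q (D : 'M[R]_(m, n)) (A : 'M_(q, n))
    (J : 'M_(n, q)) :
  q = (n - \rank D)%N -> A *m J = 1%:M -> D *m J = 0 -> (J^T == nullspace D)%MS.
Proof.
move=> eq AJ DJ.
have sJ : (J^T <= nullspace D)%MS.
  by apply/sub_kermxP; rewrite -trmx_mul DJ trmx0.
rewrite -(mxrank_leqif_eq sJ) rank_nullspace mxrank_tr -eq eqn_leq rank_leq_col.
by rewrite -{1}(mxrank1 R q) -AJ mxrankM_maxr.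
Qed.

Lemma col_normalize (R : realType) m n p (D : 'M[R]_(m, n)) (X : 'M[R]_(n, p)) k :
  col k (normalize_atoms D X) = (l1norm (D *m col k X))^-1 *: col k X.
Proof. by apply/colP => i; rewrite !mxE mulrC. Qed.

(** * Exact dictionaries *)

(** The penalty ||Df||_1 is the gauge of the dictionary: together the three
    clauses make it the minimum of ||b||_1 over the representations
    f = X b + J c (the first two give the lower bound [exact_penalty_le]). *)
Definition exact_dictionary (R : realType) m n p q (D : 'M[R]_(m, n))
    (X : 'M[R]_(n, p)) (J : 'M[R]_(n, q)) : Prop :=
  [/\ D *m J = 0, forall k, l1norm (D *m col k X) = 1
    & forall f, exists b c, f = X *m b + J *m c /\ l1norm b <= l1norm (D *m f)].

Lemma exact_penalty_le (R : realType) m n p q (D : 'M[R]_(m, n))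
    (X : 'M[R]_(n, p)) (J : 'M[R]_(n, q)) b c :
  exact_dictionary D X J -> l1norm (D *m (X *m b + J *m c)) <= l1norm b.
Proof.
case=> DJ X1 _; rewrite mulmxDr [D *m (J *m c)]mulmxA DJ mul0mx addr0 mulmxA.
apply: le_trans (l1norm_mulmx_le _ _) _; apply: ler_sum => k _.
by rewrite col_mulmx X1 mulr1.
Qed.

(** The synthesis objective at b dominates the analysis objective at the signal
    of b, and each signal has some b that attains equality; minimizers therefore
    correspond. *)
Lemma exact_equivalent (R : realType) m n p q (D : 'M[R]_(m, n))
    (X : 'M[R]_(n, p)) (J : 'M[R]_(n, q)) :
  exact_dictionary D X J -> equivalent_synthesis D X J.
Proof.
move=> ex Y lambda lambda0 f; have [_ _ rep] := ex.
have AS b : analysis_objective D Y lambda (X *m b.1 + J *m b.2)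
    <= synthesis_objective X J Y lambda b.
  by apply/lerD/ler_wpM2l/exact_penalty_le; rewrite // mulr_ge0 // ltW.
have SA g : exists b, g = X *m b.1 + J *m b.2 /\
    synthesis_objective X J Y lambda b <= analysis_objective D Y lambda g.
  have [b [c [-> le_b]]] := rep g; exists (b, c); split=> //.
  by apply/lerD/ler_wpM2l/le_b; rewrite // mulr_ge0 // ltW.
split=> [minf|[b minb ->] g].
  have [b [fE le_b]] := SA f; exists b => // b'.
  by apply: le_trans le_b (le_trans (minf _) (AS b')).
have [b' [_ le_b']] := SA g.
exact: le_trans (AS b) (le_trans (minb b') le_b').
Qed.

(** If the atom k is X' (w1 - w2) with nonnegative w1, w2 of total mass one,
    and X' collects the other atoms, then its coefficient b_k can be traded for
    b_k (w1 - w2), which has l1-norm at most |b_k|. *)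
Lemma exact_discard (R : realType) m n p q (D : 'M[R]_(m, n))
    (X : 'M[R]_(n, p)) (J : 'M[R]_(n, q)) k :
  redundant X k -> exact_dictionary D X J -> exact_dictionary D (col' k X) J.
Proof.
case=> w [w0 w1 Xk] [DJ X1 rep]; split=> //.
  move=> j; rewrite -[RHS](X1 (lift k j)); congr (l1norm (_ *m _)).
  by apply/colP => i; rewrite !mxE.
move=> f; have [b [c [fE le_b]]] := rep f.
exists (row' k b + b k 0 *: (usubmx w - dsubmx w)), c; split.
  rewrite {1}fE (mulmx_col' k); congr (_ + _); rewrite mulmxDr addrC; congr (_ + _).
  by rewrite -scalemxAr Xk -{1}[w]vsubmxK mul_row_col mulmxBr mulNmx.
apply: le_trans le_b; rewrite (l1norm_row' k) [leRHS]addrC.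
apply: le_trans (l1normD _ _) _; rewrite lerD2l l1normZ ler_piMr //.
have <- : l1norm w = 1 by rewrite -w1; apply: eq_bigr => i _; rewrite ger0_norm.
rewrite -{3}[w]vsubmxK l1norm_col_mx.
by apply: le_trans (l1normD _ _) _; rewrite -scaleN1r l1normZ normrN1 mul1r.
Qed.

Lemma prunes_to_exact (R : realType) m n p p' q (D : 'M[R]_(m, n))
    (X : 'M[R]_(n, p)) (X' : 'M[R]_(n, p')) (J : 'M[R]_(n, q)) :
  prunes_to X X' -> exact_dictionary D X J -> exact_dictionary D X' J.
Proof. by elim=> // {}p {}p' {}X k {}X' Xk _ IH /(exact_discard Xk). Qed.

(** Each discarded column lowers the number of columns, so pruning stops;
    whether some column is redundant is decided classically. *)
Lemma prunes_to_exists (R : realType) n p (X : 'M[R]_(n, p)) :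
  exists q (Z : 'M[R]_(n, q)), prunes_to X Z.
Proof.
elim: p X => [|p IH] X.
  by exists 0%N, X; apply: prunes_stop => -[].
have [[k Xk]|Xirr] := EM (exists k, redundant X k).
  by have [q [Z XZ]] := IH (col' k X); exists q, Z; apply: (prunes_discard Xk).
by exists p.+1, X; apply: prunes_stop => k Xk; apply: Xirr; exists k.
Qed.

(** * Conformal decomposition *)

(** The vectors Df for f elementary are the support-minimal vectors of the range
    of D, that is, the vertices of the l1-ball of this range up to scaling. *)
Definition elementary (R : realType) m n (D : 'M[R]_(m, n)) (f : 'cV[R]_n) : Prop :=
  D *m f <> 0 /\ forall g : 'cV_n,
    (forall i, (D *m f) i 0 = 0 -> (D *m g) i 0 = 0) ->
    exists c, D *m g = c *: (D *m f).

(** Take v = Df and w = Dg supported in the support of v but not proportional to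
    v, and let a < b be the extreme values of the ratios w_i / v_i over this
    support. Both w - a v and b v - w have coordinates of the same sign as those
    of v, their sum is (b - a) v, and each vanishes at an additional index,
    where the minimum, respectively the maximum, is attained. *)
Lemma conformal_split (R : realType) m n (D : 'M[R]_(m, n)) (f : 'cV[R]_n) :
  D *m f <> 0 -> ~ elementary D f ->
  exists f1 f2, [/\ f = f1 + f2, l1norm (D *m f) = l1norm (D *m f1) + l1norm (D *m f2)
    & forall f', f' = f1 \/ f' = f2 ->
       [set i | (D *m f') i 0 != 0] \proper [set i | (D *m f) i 0 != 0]].
Proof.
move=> Df0 nel.
have [g supp_g g_indep] : exists2 g : 'cV_n,
    (forall i, (D *m f) i 0 = 0 -> (D *m g) i 0 = 0)
    & (forall c, D *m g <> c *: (D *m f)).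
  apply: contrapT => no_g; apply: nel; split=> // g supp_g.
  by apply: contrapT => no_c; apply: no_g; exists g => // c gE; apply: no_c; exists c.
have [[v Df] [w Dg]] : (exists v, D *m f = v) /\ (exists w, D *m g = w).
  by split; eexists.
rewrite Df Dg in supp_g g_indep Df0 *.
have [i0 vi0] : exists i, v i 0 != 0.
  apply: contrapT => v0; apply: Df0; apply/colP => i; rewrite [RHS]mxE.
  by apply: contrapT => /eqP vi; apply: v0; exists i.
pose ratio i := w i 0 / v i 0.
have wE i : w i 0 = ratio i * v i 0.
  have [vi|vi] := eqVneq (v i 0) 0; first by rewrite vi supp_g ?mulr0.
  by rewrite /ratio divfK.
case: (Order.TotalTheory.arg_minP ratio (P := fun i => v i 0 != 0) vi0) => ia via min_a.
case: (Order.TotalTheory.arg_maxP ratio (P := fun i => v i 0 != 0) vi0) => ib vib max_b.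
set a := ratio ia in min_a; set b := ratio ib in max_b.
have {}max_b i : v i 0 != 0 -> ratio i <= b by apply: max_b.
have lt_ab : a < b.
  rewrite lt_neqAle max_b // andbT; apply/eqP => eq_ab.
  apply: (g_indep a); apply/colP => i; rewrite mxE wE.
  have [->|vi] := eqVneq (v i 0) 0; first by rewrite !mulr0.
  by congr (_ * _); apply/le_anti; rewrite min_a // eq_ab max_b.
have ba0 : 0 < b - a by rewrite subr_gt0.
exists ((b - a)^-1 *: (g - a *: f)), ((b - a)^-1 *: (b *: f - g)).
have D1 i : (D *m ((b - a)^-1 *: (g - a *: f))) i 0
    = (b - a)^-1 * (ratio i - a) * v i 0.
  by rewrite -scalemxAr mulmxBr -scalemxAr Df Dg !mxE wE; ring.
have D2 i : (D *m ((b - a)^-1 *: (b *: f - g))) i 0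
    = (b - a)^-1 * (b - ratio i) * v i 0.
  by rewrite -scalemxAr mulmxBr -scalemxAr Df Dg !mxE wE; ring.
split.
- rewrite -scalerDr [X in _ *: X]addrC addrA subrK -scalerBl scalerA mulVf ?scale1r //.
  exact: lt0r_neq0.
- rewrite -big_split /=; apply: eq_bigr => i _; rewrite D1 D2.
  have [->|vi] := eqVneq (v i 0) 0; first by rewrite !mulr0 normr0 addr0.
  have [ra rb] : 0 <= ratio i - a /\ 0 <= b - ratio i.
    by rewrite !subr_ge0 min_a ?max_b.
  rewrite !normrM -mulrDl (ger0_norm ra) (ger0_norm rb) -mulrDr.
  rewrite (_ : ratio i - a + (b - ratio i) = b - a); last by ring.
  rewrite ger0_norm ?invr_ge0 ?ltW //.
  by rewrite mulVf ?mul1r // lt0r_neq0.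
- move=> f' f'E; apply/properP; split.
    apply/subsetP => i; rewrite !inE; apply: contraNN => /eqP vi.
    by case: f'E => ->; rewrite ?D1 ?D2 vi mulr0.
  case: f'E => ->; [exists ia|exists ib]; rewrite !inE // ?D1 ?D2 negbK.
    by rewrite /a subrr mulr0 mul0r.
  by rewrite /b subrr mulr0 mul0r.
Qed.

Lemma conformal_ind (R : realType) m n (D : 'M[R]_(m, n)) (P : 'cV[R]_n -> Prop) :
  (forall f, D *m f = 0 -> P f) -> (forall f, elementary D f -> P f) ->
  (forall f g, l1norm (D *m (f + g)) = l1norm (D *m f) + l1norm (D *m g) ->
     P f -> P g -> P (f + g)) ->
  forall f, P f.
Proof.
move=> P0 Pel PD f.
have [k] := ubnP #|[set i | (D *m f) i 0 != 0]|.
elim: k f => // k IH f /ltnSE le_k.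
have [Df0|Df0] := EM (D *m f = 0); first exact: P0.
have [|nel] := EM (elementary D f); first exact: Pel.
have [f1 [f2 [fE norm_f lt_supp]]] := conformal_split Df0 nel.
rewrite fE in norm_f *; apply: PD => //; apply: IH.
  by apply: leq_trans (proper_card (lt_supp _ (or_introl _))) le_k.
by apply: leq_trans (proper_card (lt_supp _ (or_intror _))) le_k.
Qed.

(** The conclusion states what the atom attached to the row j of T looks like
    without mentioning A: any x whose image under D_T is the j-th unit vector is,
    modulo the nullspace of D, a nonzero multiple of f. Here T consists of a
    basis T' of the rows vanishing at f and of one more row i. A vector killed by
    D_T' is sent to a multiple of Df since f is elementary; if it is killed by row
    i too, the multiple is zero. So D_T has rank at least r, while T' has fewer
    than r elements because f is not in the nullspace. *)
Lemma elementary_basis (R : realType) m n (D : 'M[R]_(m, n)) (f : 'cV[R]_n) :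
  elementary D f -> exists (T : {set 'I_m}) (j : 'I_#|T|),
    T \in row_bases D (\rank D) /\
    forall x, subrows D T *m x = delta_mx j 0 ->
      exists2 c, c != 0 & D *m x = c *: (D *m f).
Proof.
case=> Df0 fel; pose S := [set i | (D *m f) i 0 == 0].
have [i fi] : exists i, (D *m f) i 0 != 0.
  apply: contrapT => v0; apply: Df0; apply/colP => i; rewrite [RHS]mxE.
  by apply: contrapT => /eqP vi; apply: v0; exists i.
have [T' [T'S cT' sT']] := subrows_basis D S.
have T'P (x : 'cV_n) : {in T', forall l, (D *m x) l 0 = 0} ->
    exists c, D *m x = c *: (D *m f).
  move=> x0; apply: fel => l fl; suff /subrows0P : subrows (D *m x) S = 0.
    by apply; rewrite inE fl.
  by rewrite -subrows_mul (submx_kernel sT') // subrows_mul; apply/subrows0P.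
have iT : i \in i |: T' by rewrite setU11.
have iT' : i \notin T' by apply/negP => /(subsetP T'S); rewrite inE (negPf fi).
have rT : (\rank D <= \rank (subrows D (i |: T')))%N.
  apply: kernel_rank_ge => x; rewrite subrows_mul => /subrows0P x0.
  have [l lT|c Dx] := T'P x; first by apply: x0; rewrite setU1r.
  have /eqP := x0 i iT; rewrite Dx mxE mulf_eq0 (negPf fi) orbF => /eqP ->.
  by rewrite scale0r.
have rS : (\rank (subrows D S) < \rank D)%N.
  rewrite ltn_neqAle mxrankS ?subrows_sub // andbT; apply/eqP => rS.
  apply: Df0; apply: kernel_rank_eq (subrows_sub D S) rS _ _ _.
  by rewrite subrows_mul; apply/subrows0P => l; rewrite inE => /eqP.
have cT : (#|i |: T'| <= \rank D)%N by rewrite cardsU1 iT' cT'.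
have rcT := rank_leq_row (subrows D (i |: T')).
exists (i |: T'), (enum_rank_in iT i); split.
  apply/row_basesP; split; apply/eqP; rewrite eqn_leq.
    by rewrite cT (leq_trans rT).
  by rewrite rT (leq_trans rcT).
move=> x; rewrite subrows_mul => /colP xE.
have xT l (lT : l \in i |: T') : (D *m x) l 0 = (l == i)%:R.
  have := xE (enum_rank_in iT l); rewrite !mxE enum_rankK_in // => ->.
  by rewrite andbT (inj_in_eq (can_in_inj (enum_rankK_in iT))).
have [l lT'|c Dx] := T'P x.
  rewrite xT ?setU1r //; case: eqP => // li; by rewrite -li lT' in iT'.
exists c => //; apply/eqP => c0; have := xT i iT.
by rewrite Dx c0 scale0r mxE eqxx => /eqP; rewrite eq_sym oner_eq0.
Qed.

(** * The full dictionary is exact *)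

(** Representability with ||b||_1 <= ||Df||_1 holds for f in the nullspace with
    b = 0, for elementary f with a single atom, and it is stable under sums
    without loss in ||D.||_1, so [conformal_ind] applies. *)
Lemma full_dictionary_exact (R : realType) m n (D : 'M[R]_(m, n))
    (A : 'M_(n - \rank D, n)) q (J : 'M_(n, q)) :
  (A == nullspace D)%MS -> (J^T == nullspace D)%MS ->
  exact_dictionary D (normalize_atoms D (raw_dictionary A D (\rank D))) J.
Proof.
move=> nullA nullJ; set X := normalize_atoms _ _.
have kerJ (x : 'cV_n) : D *m x = 0 -> exists c, x = J *m c.
  move=> /nullspaceP; rewrite -(eqmxP nullJ) => /submxP [u xu].
  by exists u^T; rewrite -[LHS]trmxK xu trmx_mul trmxK.
split.
- apply: trmx_inj; rewrite trmx_mul trmx0; apply/sub_kermxP.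
  by rewrite -/(nullspace D) -(eqmxP nullJ).
- move=> k; rewrite col_normalize -scalemxAr l1normZ.
  have [T [j [TD ->]]] := col_raw_dictionary A k.
  by rewrite normfV ger0_norm ?l1norm_ge0 // mulVf // atom_neq0.
elim/(conformal_ind (D := D)) => [f Df0|f fel|f g norm_fg].
- have [c ->] := kerJ f Df0; exists 0, c.
  by rewrite mulmx0 add0r l1norm0 l1norm_ge0.
- have [T [j [TD coelem]]] := elementary_basis fel.
  have [k kE] := atom_raw_dictionary A j TD.
  set x := col j _ in kE.
  have [a a0 Dx] := coelem x (atomP nullA j TD).
  have [|c fE] := kerJ (f - a^-1 *: x).
    by rewrite mulmxBr -scalemxAr Dx scalerA mulVf // scale1r subrr.
  (* f is x / a modulo the nullspace and x is ||Dx||_1 times its normalized atom. *)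
  exists ((l1norm (D *m x) / a) *: delta_mx k 0), c; split.
    rewrite -fE -scalemxAr -colE col_normalize kE scalerA mulrAC divff ?atom_neq0 //.
    by rewrite mul1r addrC subrK.
  rewrite l1normZ l1norm_delta mulr1 Dx l1normZ normrM normrM normr_id normfV.
  by rewrite mulrAC divff ?normr_eq0 // mul1r ger0_norm ?l1norm_ge0.
- move=> [b [c [fE le_b]]] [b' [c' [gE le_b']]]; exists (b + b'), (c + c').
  rewrite norm_fg !mulmxDr addrACA -fE -gE; split=> //.
  exact: le_trans (l1normD _ _) (lerD le_b le_b').
Qed.

Theorem theorem4p1 (R : realType) (m n r : nat) (D : 'M[R]_(m, n))
    (r_le : (r <= minn m n)%N) (rankD : \rank D = r) :
  [/\ exists T, T \in row_bases D r,
      forall T, T \in row_bases D r ->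
        (nullspace (subrows D T) == nullspace D)%MS,
      exists A : 'M[R]_(n - r, n), (A == nullspace D)%MS
    & forall A : 'M[R]_(n - r, n), (A == nullspace D)%MS ->
      exists J : 'M[R]_(n, n - r),
      [/\ (J^T == nullspace D)%MS,
          forall T, T \in row_bases D r ->
            stacked A D T *m row_mx J (atoms_block A D T) = 1%:M /\
            row_mx J (atoms_block A D T) *m stacked A D T = 1%:M,
          forall k,
            l1norm (col k (D *m normalize_atoms D (raw_dictionary A D r))) = 1,
          exists q (X : 'M[R]_(n, q)),
            prunes_to (normalize_atoms D (raw_dictionary A D r)) X
        & forall q (X : 'M[R]_(n, q)),
            prunes_to (normalize_atoms D (raw_dictionary A D r)) X ->
            equivalent_synthesis D X J]].
Proof.
case: r / rankD r_le => _; have [T0 T0D] := row_bases_neq0 D.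
split; [by exists T0 | exact: row_bases_nullspace | |move=> A nullA].
  by rewrite -rank_nullspace; exists (row_base (nullspace D)); apply/eqmxP/eq_row_base.
have [AJ DJ _] := stacked_blocks nullA T0D.
set J := lsubmx _ in AJ DJ; have nullJ := kernel_block_span erefl AJ DJ.
have exX := full_dictionary_exact nullA nullJ.
exists J; split=> //.
- by move=> T TD; rewrite stacked_inv_kernel_block //; apply: stacked_invP.
- by move=> k; rewrite col_mulmx; case: exX.
- exact: prunes_to_exists.
- by move=> q X /prunes_to_exact/(_ exX); apply: exact_equivalent.
Qed.
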